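(* Let $\mathcal T=\bigcup_{n\ge1}\mathcal T_n$, where $\mathcal T_n$ is the set of invertible real $n\times n$ matrices. For $A\in\mathcal T_m$, $B\in\mathcal T_n$, $t=\mathrm{lcm}(m,n)$ put $A\ltimes B:=(A\otimes I_{t/m})(B\otimes I_{t/n})$. Then $(\mathcal T,\ltimes)$ is a hyper group with identity set $\mathbf e=\{I_n: n\ge1\}$ indexed by the positive integers ordered by divisibility.
   Context: $\otimes$ is the Kronecker product, $I_n$ the $n\times n$ identity matrix. Hyper group: Let $(G,* )$ be a semigroup. A subset $\mathbf e\subset G$ is an identity set if (i) $g*e=e*g$ for all $g\in G$, $e\in\mathbf e$; (ii) $\mathbf e=\{e_\lambda:\lambda\in\Lambda\}$ is indexed without repetition by a lattice $(\Lambda,\le)$ and $e_\lambda*e_\mu=e_{\lambda\vee\mu}$; (iii) for each $g\in G$ there is a unique $e_g=e_{\lambda_g}\in\mathbf e$ such that for all $\lambda\in\Lambda$: $e_\lambda*g=g$ if and only if $\lambda\le\lambda_g$. A hyper group $(G,*,\mathbf e)$ is a semigroup with an identity set such that for each $g\in G$ there is $g^{-1}\in G$ with $g*g^{-1}=g^{-1}*g=e_g$. *)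

(* Defs.v *)
From HB Require Import structures.
From mathcomp Require Import all_boot all_order all_algebra.
From mathcomp Require Import classical_sets reals.
From mathcomp Require Export mxtens.

Set Implicit Arguments.
Unset Strict Implicit.
Unset Printing Implicit Defensive.

Import Order.TTheory GRing.Theory.
Local Open Scope ring_scope.

Section HyperGroup.
Context {disp : Order.disp_t} {L : latticeType disp} {G : Type}.
Implicit Types (op : G -> G -> G) (E : set G) (e : L -> G).

(* [e l] is the local identity e_g: the k with e k * g = g are those below l. *)
Definition local_index op e (g : G) (l : L) : Prop :=
  forall k : L, op (e k) g = g <-> (k <= l)%O.

(* [E] is the underlying subset, [e] its indexing by the lattice [L]. *)
Record identity_set op E e : Prop := IdentitySet {
  identity_comm : forall g x : G, E x -> op g x = op x g;
  identity_range : E = range e;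
  identity_inj : injective e;
  identity_join : forall k l : L, op (e k) (e l) = e (Order.join k l);
  identity_local : forall g : G, exists! l : L, local_index op e g l
}.

Record hyper_group op E e : Prop := HyperGroup {
  hyper_assoc : associative op;
  hyper_identity : identity_set op E e;
  hyper_inv : forall (g : G) (l : L), local_index op e g l ->
    exists h : G, op g h = e l /\ op h g = e l
}.

End HyperGroup.

(* Sublattice of the divisibility lattice [natdvd]; 0 is its top element and
   has to be removed. *)
Record posdvd := PosDvd { posval : natdvd; posval_gt0 : (0 < posval)%N }.

HB.instance Definition _ := [isSub for posval].
HB.instance Definition _ := [Choice of posdvd by <:].

Fact posdvd_meet_closed :
  {in [pred n : natdvd | (0 < n)%N] &, forall m n,
    Order.meet m n \in [pred n : natdvd | (0 < n)%N]}.
Proof. by move=> m n; rewrite !inE /= => m0 n0; rewrite gcdEnat gcdn_gt0 m0. Qed.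

Fact posdvd_join_closed :
  {in [pred n : natdvd | (0 < n)%N] &, forall m n,
    Order.join m n \in [pred n : natdvd | (0 < n)%N]}.
Proof. by move=> m n; rewrite !inE /= => m0 n0; rewrite lcmEnat lcmn_gt0 m0. Qed.

HB.instance Definition _ :=
  Order.SubChoice_isSubLattice.Build Order.dvd_display natdvd
    (fun n : natdvd => (0 < n)%N) Order.dvd_display posdvd
    posdvd_meet_closed posdvd_join_closed.

Lemma posdvd_leE (m n : posdvd) : (m <= n)%O = (posval m %| posval n)%N.
Proof. by []. Qed.

Lemma posdvd_joinE (m n : posdvd) : posval (Order.join m n) = lcmn (posval m) (posval n).
Proof. by []. Qed.

Lemma posdvd_meetE (m n : posdvd) : posval (Order.meet m n) = gcdn (posval m) (posval n).
Proof. by []. Qed.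

Section SemiTensorProduct.
Variable R : fieldType.

Record regmx := RegMx {
  rdim : nat;
  rmat : 'M[R]_rdim;
  rdim_gt0 : (0 < rdim)%N;
  rmat_unit : rmat \in unitmx
}.

Fact kron_dim (n t : nat) : (n %| t)%N -> (n * (t %/ n))%N = t.
Proof. by move=> nt; rewrite mulnC divnK. Qed.

(* A (x) I_(t/n), transported along n * (t/n) = t *)
Definition kron_id (n t : nat) (nt : (n %| t)%N) (A : 'M[R]_n) : 'M[R]_t :=
  castmx (kron_dim nt, kron_dim nt) (tensmx A (1%:M : 'M[R]_(t %/ n))).

Lemma castmx_unitmx (m n : nat) (e : m = n) (A : 'M[R]_m) :
  A \in unitmx -> castmx (e, e) A \in unitmx.
Proof. by case: n / e; rewrite castmx_id. Qed.

Lemma kron_id_unit (n t : nat) (nt : (n %| t)%N) (A : 'M[R]_n) :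
  (0 < t)%N -> A \in unitmx -> kron_id nt A \in unitmx.
Proof.
move=> t0 uA; have n0 : (0 < n)%N := dvdn_gt0 t0 nt.
have q0 : (0 < t %/ n)%N by rewrite divn_gt0 // dvdn_leq.
apply: castmx_unitmx; apply: tensmx_unit; last exact: unitmx1.
- by rewrite -lt0n.
- by rewrite -lt0n.
- exact: uA.
Qed.

Definition stp_mx (m n : nat) (A : 'M[R]_m) (B : 'M[R]_n) : 'M[R]_(lcmn m n) :=
  kron_id (dvdn_lcml m n) A *m kron_id (dvdn_lcmr m n) B.

Fact stp_dim_gt0 (A B : regmx) : (0 < lcmn (rdim A) (rdim B))%N.
Proof. by rewrite lcmn_gt0 !rdim_gt0. Qed.

Fact stp_unit (A B : regmx) : stp_mx (rmat A) (rmat B) \in unitmx.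
Proof.
by rewrite unitmx_mul !kron_id_unit ?stp_dim_gt0 ?rmat_unit.
Qed.

Definition stp (A B : regmx) : regmx := RegMx (stp_dim_gt0 A B) (stp_unit A B).

Definition regid (n : posdvd) : regmx :=
  RegMx (posval_gt0 n) (unitmx1 R (posval n)).

End SemiTensorProduct.

(* Main.v *)
Require Import Defs.
From mathcomp Require Import all_boot all_order all_algebra.
From mathcomp Require Import classical_sets reals.

(** For each multiple [t] of [n], the map [A |-> A (x) I_(t/n)] embeds the
    [n x n] matrices into the [t x t] ones.  These maps are multiplicative
    ([kron_id_mul]), preserve the identity ([kron_id1]), are trivial for
    [t = n] ([kron_idnn]) and compose along [n %| u %| t] ([kron_id_trans]), so
    that they form a directed system of monoid morphisms over the divisibility
    order.  The product of [A] and [B] is computed by embedding both at the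
    level [lcm m n] and multiplying there.

    The axioms follow.  Both bracketings of a triple product are the product of
    the three images at the level [lcm m n p].  Since [I_k] is sent to [I_t],
    multiplying by [I_k], on either side, sends [A] to its image at the level
    [lcm k m]; this is [A] itself precisely when [lcm k m = m], that is when
    [k %| m], so the local identity of [A] is [I_m].  Two matrices of the same
    size have their ordinary product, and the usual inverse is therefore an
    inverse relative to [I_m]. *)

Set Implicit Arguments.
Unset Strict Implicit.
Unset Printing Implicit Defensive.

Import Order.TTheory GRing.Theory.
Local Open Scope ring_scope.

Section KronId.
Variable R : fieldType.
Implicit Types m n t u : nat.

Lemma kron_idE n t (nt : (n %| t)%N) (A : 'M[R]_n) i j :
  let src k := (mxtens_unindex (cast_ord (esym (kron_dim nt)) k)).1 in
  kron_id nt A i j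
    = A (src i) (src j) * (i == j %[mod t %/ n])%:R.
Proof. by rewrite /= /kron_id castmxE !mxE -val_eqE. Qed.

Lemma eqn_mod_mul (i j p q : nat) : (0 < q)%N ->
  (i == j %[mod p * q])
    = (i == j %[mod q]) && (i %/ q == j %/ q %[mod p]).
Proof.
move=> q0.
have split_mod k : (k %% (p * q) = (k %/ q %% p) * q + k %% q)%N.
  rewrite [LHS](divn_eq _ q) -modn_divl; congr (_ + _)%N.
  by rewrite modn_dvdm // dvdn_mull.
by rewrite !split_mod eq_addl_mul ?ltn_mod // xpair_eqE andbC.
Qed.

(** This amounts to [I_(u/n) (x) I_(t/u) = I_(t/n)], which is read on the
    entries: with [q = t / u], a residue modulo [t / n] is determined by its
    quotient by [q], modulo [u / n], and by its remainder modulo [q]. *)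
Lemma kron_id_trans n u t (nu : (n %| u)%N) (ut : (u %| t)%N)
    (nt : (n %| t)%N) (A : 'M[R]_n) :
  kron_id ut (kron_id nu A) = kron_id nt A.
Proof.
apply/matrixP=> i j.
have t0 : (0 < t)%N by exact: leq_ltn_trans (ltn_ord i).
have u0 : (0 < u)%N := dvdn_gt0 t0 ut.
have q0 : (0 < t %/ u)%N by rewrite divn_gt0 // dvdn_leq.
have fact_q : (t %/ n = u %/ n * (t %/ u))%N.
  by rewrite -{1}(divnK ut) -muln_divA // mulnC.
rewrite !kron_idE -mulrA /=; congr (A _ _ * _).
- by apply: val_inj; rewrite /= -divnMA mulnC fact_q.
- by apply: val_inj; rewrite /= -divnMA mulnC fact_q.
by rewrite -natrM mulnb fact_q eqn_mod_mul // andbC.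
Qed.

Lemma kron_idnn n (nn : (n %| n)%N) (A : 'M[R]_n) : kron_id nn A = A.
Proof.
apply/matrixP=> i j; have n0 : (0 < n)%N by exact: leq_ltn_trans (ltn_ord i).
have q1 : (n %/ n = 1)%N by rewrite divnn n0.
rewrite kron_idE -[RHS]mulr1 /=; congr (A _ _ * _).
- by apply: val_inj; rewrite /= q1 divn1.
- by apply: val_inj; rewrite /= q1 divn1.
by rewrite q1 !modn1.
Qed.

Lemma kron_id1 n t (nt : (n %| t)%N) : kron_id nt (1%:M : 'M[R]_n) = 1%:M.
Proof.
apply/matrixP=> i j.
rewrite kron_idE !mxE -!val_eqE /= -natrM mulnb; congr (nat_of_bool _)%:R.
have t0 : (0 < t)%N by exact: leq_ltn_trans (ltn_ord i).
have n0 : (0 < n)%N := dvdn_gt0 t0 nt.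
have q0 : (0 < t %/ n)%N by rewrite divn_gt0 // dvdn_leq.
apply/andP/eqP=> [[/eqP eq_div /eqP eq_mod]|->]; last by [].
by rewrite (divn_eq i (t %/ n)) eq_div eq_mod -divn_eq.
Qed.

Lemma castmx_mulmx m n (e : m = n) (A B : 'M[R]_m) :
  castmx (e, e) (A *m B) = castmx (e, e) A *m castmx (e, e) B.
Proof. by case: n / e; rewrite !castmx_id. Qed.

Lemma castmx1 m n (e : m = n) : castmx (e, e) (1%:M : 'M[R]_m) = 1%:M.
Proof. by case: n / e; rewrite castmx_id. Qed.

Lemma kron_id_mul n t (nt : (n %| t)%N) (A B : 'M[R]_n) :
  kron_id nt (A *m B) = kron_id nt A *m kron_id nt B.
Proof. by rewrite /kron_id -castmx_mulmx tensmx_mul mulmx1. Qed.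

(** Stating the size [t] up to a propositional equality lets two products be
    compared at one common level, whatever form their sizes take. *)
Lemma castmx_stp m n t (e : lcmn m n = t) (mt : (m %| t)%N) (nt : (n %| t)%N)
    (A : 'M[R]_m) (B : 'M[R]_n) :
  castmx (e, e) (stp_mx A B) = kron_id mt A *m kron_id nt B.
Proof.
case: t / e mt nt => mt nt; rewrite castmx_id /stp_mx.
by rewrite (bool_irrelevance mt (dvdn_lcml m n))
  (bool_irrelevance nt (dvdn_lcmr m n)).
Qed.

End KronId.

Section RegularMatrices.
Variable R : fieldType.
Implicit Types (A B C : regmx R) (k l : posdvd).

Lemma regmx_eq A B t (eA : rdim A = t) (eB : rdim B = t) :
  castmx (eA, eA) (rmat A) = castmx (eB, eB) (rmat B) -> A = B.
Proof.
case: t / eB eA; case: A B => [m A m0 uA] [n B n0 uB] /= e.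
case: n / e B n0 uB => B n0 uB; rewrite !castmx_id => eqAB.
by case: B / eqAB uB => uB; congr RegMx; apply: bool_irrelevance.
Qed.

Lemma stp_assoc : associative (@stp R).
Proof.
move=> A B C.
set m := rdim A; set n := rdim B; set p := rdim C.
set t := lcmn (lcmn m n) p.
have e : lcmn m (lcmn n p) = t by rewrite lcmnA.
have mn_t : (lcmn m n %| t)%N := dvdn_lcml _ _.
have p_t : (p %| t)%N := dvdn_lcmr _ _.
have m_t : (m %| t)%N := dvdn_trans (dvdn_lcml m n) mn_t.
have n_t : (n %| t)%N := dvdn_trans (dvdn_lcmr m n) mn_t.
have np_t : (lcmn n p %| t)%N by rewrite dvdn_lcm n_t.
refine (@regmx_eq (stp A (stp B C)) (stp (stp A B) C) t e (erefl t) _).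
rewrite (castmx_stp e m_t np_t) (castmx_stp (erefl t) mn_t p_t) /= /stp_mx.
by rewrite !kron_id_mul !(kron_id_trans _ _ m_t, kron_id_trans _ _ n_t,
  kron_id_trans _ _ p_t) mulmxA.
Qed.

Lemma stp_regidC A k : stp A (regid R k) = stp (regid R k) A.
Proof.
refine (@regmx_eq (stp A (regid R k)) (stp (regid R k) A)
  _ (lcmnC _ _) (erefl _) _).
rewrite (castmx_stp _ (dvdn_lcmr _ _) (dvdn_lcml _ _)).
rewrite (castmx_stp _ (dvdn_lcml _ _) (dvdn_lcmr _ _)) /=.
by rewrite !kron_id1 mul1mx mulmx1.
Qed.

Lemma stp_regid k l :
  stp (regid R k) (regid R l) = regid R (Order.join k l).
Proof.
apply: (@regmx_eq (stp (regid R k) (regid R l)) (regid R (Order.join k l))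
  _ (erefl _) (posdvd_joinE k l)).
rewrite (castmx_stp _ (dvdn_lcml _ _) (dvdn_lcmr _ _)) /=.
by rewrite !kron_id1 mul1mx castmx1.
Qed.

(** The sizes force [k %| rdim A]; conversely, at the level [rdim A] the matrix
    [A] is embedded as itself and [I_k] as the identity. *)
Lemma regid_stp_id A k : stp (regid R k) A = A <-> (posval k %| rdim A)%N.
Proof.
split=> [/(congr1 (@rdim R)) /= <-|kA]; first exact: dvdn_lcml.
have e : lcmn (posval k) (rdim A) = rdim A by apply/lcmn_idPr.
refine (@regmx_eq (stp (regid R k) A) A _ e (erefl _) _).
by rewrite (castmx_stp e kA (dvdnn _)) kron_id1 mul1mx kron_idnn castmx_id.
Qed.

Lemma local_index_regmx A l :
  local_index (@stp R) (@regid R) A l <-> posval l = rdim A.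
Proof.
split=> [locA|eqlA k]; last first.
  by rewrite posdvd_leE eqlA; apply: regid_stp_id.
apply/eqP; rewrite eqn_dvd; apply/andP; split; first exact/regid_stp_id/locA.
(* [I_m] fixes [A] for [m = rdim A], so that [m] is below [l] *)
have /locA := (regid_stp_id A (PosDvd (rdim_gt0 A))).2 (dvdnn _).
by rewrite posdvd_leE.
Qed.

Lemma stp_inverse A l : posval l = rdim A ->
  exists B, stp A B = regid R l /\ stp B A = regid R l.
Proof.
move=> e; set m := rdim A in e *.
have uA := rmat_unit A.
have uV : invmx (rmat A) \in unitmx by rewrite unitmx_inv.
have mm : lcmn m m = m by apply/lcmn_idPr.
pose B := RegMx (rdim_gt0 A) uV.
exists B; split.
- refine (@regmx_eq (stp A B) (regid R l) m mm e _).
  by rewrite (castmx_stp _ (dvdnn m) (dvdnn m)) !kron_idnn mulmxV // castmx1.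
- refine (@regmx_eq (stp B A) (regid R l) m mm e _).
  by rewrite (castmx_stp _ (dvdnn m) (dvdnn m)) !kron_idnn mulVmx // castmx1.
Qed.

End RegularMatrices.

Local Open Scope classical_set_scope.

Theorem proposition3p10 (R : realType) :
  hyper_group (@stp R) [set @regid R n | n in [set: posdvd]] (@regid R).
Proof.
split.
- exact: stp_assoc.
- split.
  + by move=> A _ [k _ <-]; apply: stp_regidC.
  + by [].
  + by move=> k l /(congr1 (@rdim R)); apply: val_inj.
  + exact: stp_regid.
  + move=> A; exists (PosDvd (rdim_gt0 A)); split.
      exact/local_index_regmx.
    by move=> l /local_index_regmx eqlA; apply: val_inj.
- by move=> A l /local_index_regmx; apply: stp_inverse.
Qed.
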